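(* Let $n\ge 1$, $z=(z_1,\dots,z_n)$, and let $P(z)\in\mathbb{C}[[z]]$ with $o(P(z))\ge 2$. The following statements are equivalent. (1) $P(z)$ is Hessian nilpotent. (2) $\Delta^m P^m=0$ for every $m\ge 1$. (3) $\Delta^m P^m=0$ for every $1\le m\le n$.
   Context: $\Delta=\sum_{i=1}^n \partial^2/\partial z_i^2$; $o(P)$ is the lowest degree of a monomial occurring in $P$. $P$ is Hessian nilpotent if its Hessian matrix $\left(\frac{\partial^2 P}{\partial z_i\partial z_j}\right)$ is nilpotent. *)

(* Defs.v *)
From HB Require Import structures.
From mathcomp Require Import all_boot all_order all_algebra.
From mathcomp Require Import boolp reals.
From mathcomp Require Import complex.
From mathcomp Require Import mpoly.

Set Implicit Arguments.
Unset Strict Implicit.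
Unset Printing Implicit Defensive.

Import GRing.Theory.
Local Open Scope ring_scope.

(* R[[z_1, ..., z_n]]: a formal power series is its family of coefficients,
   indexed by the monomials 'X_{1..n} of the multinomials library. *)
Record fpseries (n : nat) (R : Type) := FPSeries { fpcoef :> 'X_{1..n} -> R }.

HB.instance Definition _ n R := gen_eqMixin (fpseries n R).
HB.instance Definition _ n R := gen_choiceMixin (fpseries n R).

Lemma fpseriesP n R (f g : fpseries n R) : (forall m, f m = g m) <-> f = g.
Proof.
split=> [|-> //]; case: f g => [f] [g] /= fg; congr FPSeries; exact: funext.
Qed.

Section Ring.
Variables (n : nat) (R : comNzRingType).
Implicit Types (f g h : fpseries n R) (m : 'X_{1..n}).

Definition fps0 : fpseries n R := FPSeries (fun=> 0).
Definition fpsN f : fpseries n R := FPSeries (fun m => - f m).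
Definition fpsD f g : fpseries n R := FPSeries (fun m => f m + g m).
Definition fps1 : fpseries n R := FPSeries (fun m => (m == 0%MM)%:R).

(* The Cauchy product; the index type 'X_{1..n < (mdeg m).+1} only serves to
   make the set of monomials k dividing m a finite one. *)
Definition fpsM f g : fpseries n R :=
  FPSeries (fun m => \sum_(k : 'X_{1..n < (mdeg m).+1} | (k <= m)%MM)
                       f k * g (m - k)%MM).

Lemma fpsDA : associative fpsD.
Proof. by move=> f g h; apply/fpseriesP=> m /=; rewrite addrA. Qed.
Lemma fpsDC : commutative fpsD.
Proof. by move=> f g; apply/fpseriesP=> m /=; rewrite addrC. Qed.
Lemma fps0D : left_id fps0 fpsD.
Proof. by move=> f; apply/fpseriesP=> m /=; rewrite add0r. Qed.
Lemma fpsND : left_inverse fps0 fpsN fpsD.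
Proof. by move=> f; apply/fpseriesP=> m /=; rewrite addNr. Qed.

HB.instance Definition _ :=
  GRing.isZmodule.Build (fpseries n R) fpsDA fpsDC fps0D fpsND.

Definition fptrunc d f : {mpoly R[n]} :=
  \sum_(k : 'X_{1..n < d}) f k *: 'X_[k].

Lemma mcoeff_fptrunc d f m :
  (fptrunc d f)@_m = if (mdeg m < d)%N then f m else 0.
Proof.
rewrite /fptrunc raddf_sum /=; case: ifP => [lt_md|/negbT ge_md].
  rewrite (bigD1 (BMultinom lt_md)) //= mcoeffZ mcoeffX eqxx mulr1.
  rewrite big1 ?addr0 // => k nk; rewrite mcoeffZ mcoeffX.
  rewrite (_ : _ == m = false) ?mulr0 //; apply/negbTE.
  by apply: contraNneq nk => kE; rewrite bmeqP /= kE.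
rewrite big1 // => k _; rewrite mcoeffZ mcoeffX.
rewrite (_ : _ == m = false) ?mulr0 //; apply/negbTE.
by apply: contraNneq ge_md => <-; apply: bmdeg.
Qed.

Lemma mcoeffM_lin (p q : {mpoly R[n]}) m :
  (p * q)@_m =
    \sum_(k : 'X_{1..n < (mdeg m).+1} | (k <= m)%MM) p@_k * q@_(m - k).
Proof. exact: mcoeff_poly_mul_lin. Qed.

Lemma fpsM_mcoeff d f g (p q : {mpoly R[n]}) m :
    (forall k, (mdeg k < d)%N -> p@_k = f k) ->
    (forall k, (mdeg k < d)%N -> q@_k = g k) ->
  (mdeg m < d)%N -> fpsM f g m = (p * q)@_m.
Proof.
move=> pf qg lt_md; rewrite mcoeffM_lin /=; apply: eq_bigr => k _.
rewrite pf ?qg //; first exact: leq_ltn_trans (mdegB _ _) lt_md.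
exact: leq_trans (bmdeg k) lt_md.
Qed.

Lemma fpsMA : associative fpsM.
Proof.
move=> f g h; apply/fpseriesP=> m; set d := (mdeg m).+1.
have trE (e : fpseries n R) k : (mdeg k < d)%N -> (fptrunc d e)@_k = e k.
  by move=> lt_kd; rewrite mcoeff_fptrunc lt_kd.
have trM e e' k : (mdeg k < d)%N ->
    (fptrunc d e * fptrunc d e')@_k = fpsM e e' k.
  by move=> lt_kd; rewrite -(fpsM_mcoeff (trE e) (trE e')).
rewrite (fpsM_mcoeff (trE f) (trM g h)) // (fpsM_mcoeff (trM f g) (trE h)) //.
by rewrite mulrA.
Qed.

Lemma fpsMC : commutative fpsM.
Proof.
move=> f g; apply/fpseriesP=> m; set d := (mdeg m).+1.
have trE (e : fpseries n R) k : (mdeg k < d)%N -> (fptrunc d e)@_k = e k.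
  by move=> lt_kd; rewrite mcoeff_fptrunc lt_kd.
rewrite (fpsM_mcoeff (trE f) (trE g)) // (fpsM_mcoeff (trE g) (trE f)) //.
by rewrite mulrC.
Qed.

Lemma fps1M : left_id fps1 fpsM.
Proof.
move=> f; apply/fpseriesP=> m; set d := (mdeg m).+1.
have trE k : (mdeg k < d)%N -> (fptrunc d f)@_k = f k.
  by move=> lt_kd; rewrite mcoeff_fptrunc lt_kd.
have oneE k : (mdeg k < d)%N -> (1 : {mpoly R[n]})@_k = fps1 k.
  by rewrite mcoeff1.
by rewrite (fpsM_mcoeff oneE trE) // mul1r trE.
Qed.

Lemma fpsMDl : left_distributive fpsM fpsD.
Proof.
move=> f g h; apply/fpseriesP=> m /=; rewrite -big_split /=.
by apply: eq_bigr => k _; rewrite mulrDl.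
Qed.

Lemma fps1_neq0 : fps1 != 0.
Proof.
by apply/eqP=> /fpseriesP/(_ 0%MM)/eqP; rewrite /= eqxx oner_eq0.
Qed.

HB.instance Definition _ := GRing.Zmodule_isComNzRing.Build (fpseries n R)
  fpsMA fpsMC fps1M fpsMDl fps1_neq0.

(* d/dz_i : the coefficient of z^m in df/dz_i is (m_i + 1) times the
   coefficient of z^m z_i in f. *)
Definition fpderiv (i : 'I_n) f : fpseries n R :=
  FPSeries (fun m => f (m + U_(i))%MM *+ (m i).+1).

Definition fphessian f : 'M[fpseries n R]_n :=
  \matrix_(i, j) fpderiv i (fpderiv j f).

Definition hessian_nilpotent f : Prop := exists k : nat, fphessian f ^+ k = 0.

Definition fplaplacian f : fpseries n R := \sum_(i < n) fpderiv i (fpderiv i f).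

(* The lowest degree of a monomial occurring in f; None stands for the order
   +oo of the zero series. *)
Definition has_monomial_of_degree f (d : nat) : bool :=
  `[< exists m : 'X_{1..n}, mdeg m = d /\ f m != 0 >].

Definition fporder f : option nat :=
  if pselect (exists d, has_monomial_of_degree f d) is left fP
  then Some (ex_minn fP) else None.

Definition fporder_ge f (d : nat) : Prop :=
  if fporder f is Some e then (d <= e)%N else True.

Lemma fporder_geP f d :
  fporder_ge f d <-> forall m, (mdeg m < d)%N -> f m = 0.
Proof.
rewrite /fporder_ge /fporder; case: pselect => [fP|fN]; last first.
  split=> // _ m _; apply/eqP/contraT => fm0; case: fN.
  by exists (mdeg m); apply/asboolP; exists m.
case: ex_minnP => e /asboolP[k [<- fk0]] kmin; split=> [le_dk m lt_md | f0].
  apply/eqP/contraT => fm0; have: (mdeg k <= mdeg m)%N.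
    by apply: kmin; apply/asboolP; exists m.
  by rewrite leqNgt (leq_trans lt_md le_dk).
by rewrite leqNgt; apply: contraNN fk0 => /f0 ->.
Qed.

End Ring.

(* Main.v *)
(* Let S(t) solve the Hamilton-Jacobi equation dS/dt = |grad S|^2, S(0) = P, and
   put u_k = tr (Hess P)^k and w_k(t) = tr (Hess S)^k. Differentiating the
   equation twice gives dw_k/dt = 2k w_(k+1) + 2 <grad S, grad w_k>, so if
   u_1 = ... = u_(m-1) = 0 then Delta S = w_1 = 2^(m-1) u_m t^(m-1) + O(t^m).
   On the other hand (k+1) dS^k/dt = Delta S^(k+1) - (k+1) S^k Delta S, so as
   long as Delta S vanishes the t^(m-1)-coefficient of S is, up to a positive
   constant, Delta^(m-1) P^m. Hence Delta^m P^m is a positive multiple of u_m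
   modulo u_1, ..., u_(m-1), and the vanishing of Delta^m P^m for m <= N is
   equivalent to that of u_m for m <= N. By the Newton identities,
   Cayley-Hamilton and the integrality of C[[z]], Hess P is nilpotent iff
   u_1 = ... = u_n = 0. *)
Require Import Defs.
From HB Require Import structures.
From mathcomp Require Import all_boot all_order all_algebra.
From mathcomp Require Import boolp reals.
From mathcomp Require Import complex.
From mathcomp Require Import mpoly.
From mathcomp Require Import ring.

Set Implicit Arguments.
Unset Strict Implicit.
Unset Printing Implicit Defensive.

Import GRing.Theory.
Local Open Scope ring_scope.

Lemma raddf_mxtrace (U V : pzRingType) (f : {additive U -> V}) n (M : 'M_n) :
  \tr (map_mx f M) = f (\tr M).
Proof. by rewrite raddf_sum; apply: eq_bigr => i _; rewrite mxE. Qed.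

Definition leibniz (B : pzRingType) (d : B -> B) :=
  forall x y, d (x * y) = d x * y + x * d y.

(** * Derivations applied to determinants and traces *)

Section Derivation.
Variables (B : comNzRingType) (d : {additive B -> B}).
Hypothesis dM : leibniz d.

Lemma leibniz1 : d 1 = 0.
Proof. by have:= dM 1 1; rewrite !mulr1 mul1r -{1}[d 1]addr0 => /addrI. Qed.

Lemma leibnizX x k : d (x ^+ k.+1) = (d x * x ^+ k) *+ k.+1.
Proof.
elim: k => [|k IHk]; first by rewrite expr1 expr0 mulr1.
by rewrite exprS dM IHk mulrnAr mulrCA -exprS [RHS]mulrS.
Qed.

Lemma leibniz_prod (I : finType) (F : I -> B) :
  d (\prod_i F i) = \sum_i d (F i) * \prod_(j | j != i) F j.
Proof.
suff H (r : seq I) : uniq r ->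
    d (\prod_(i <- r) F i)
      = \sum_(i <- r) d (F i) * \prod_(j <- r | j != i) F j.
  exact: H (index_enum_uniq I).
elim: r => [|a r IHr] /=; first by rewrite !big_nil leibniz1.
case/andP=> a_r /IHr {}IHr; rewrite !big_cons dM eqxx /= IHr; congr (_ * _ + _).
  rewrite [LHS]big_seq [RHS]big_seq_cond; apply: eq_bigl => i.
  by case: (boolP (i \in r)) => // i_r; apply/esym; apply: contraNneq a_r => <-.
rewrite mulr_sumr !big_seq; apply: eq_bigr => i i_r; rewrite big_cons mulrCA.
by rewrite (_ : a != i) //; apply: contraNneq a_r => ->.
Qed.

Lemma leibniz_mulmx m n p (M : 'M_(m, n)) (N : 'M_(n, p)) :
  map_mx d (M *m N) = map_mx d M *m N + M *m map_mx d N.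
Proof.
apply/matrixP=> i j; rewrite !mxE raddf_sum -big_split /=.
by apply: eq_bigr => l _; rewrite !mxE dM.
Qed.

(** Jacobi's formula: differentiate one row at a time and expand each determinant along that row. *)
Lemma leibniz_det n (M : 'M_n) : d (\det M) = \tr (map_mx d M *m \adj M).
Proof.
transitivity (\sum_i \sum_j d (M i j) * cofactor M i j); last first.
  by apply: eq_bigr => i _; rewrite !mxE; apply: eq_bigr => j _; rewrite !mxE.
pose Mi i : 'M_n := \matrix_(k, j) (if k == i then d (M k j) else M k j).
transitivity (\sum_i \det (Mi i)); last first.
  apply: eq_bigr => i _; rewrite (expand_det_row _ i); apply: eq_bigr => j _.
  rewrite mxE eqxx /cofactor; congr (_ * (_ * \det _)).
  by apply/matrixP=> k l; rewrite !mxE eq_sym (negPf (neq_lift _ _)).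
rewrite raddf_sum exchange_big; apply: eq_bigr => s _ /=.
rewrite -mulr_sumr.
have -> (b : bool) x : d ((-1) ^+ b * x) = (-1) ^+ b * d x.
  by rewrite !mulr_sign; case: ifP => _; rewrite ?raddfN.
congr (_ * _).
rewrite leibniz_prod; apply: eq_bigr => i _.
rewrite [RHS](bigD1 i) //= mxE eqxx; congr (_ * _).
by apply: eq_bigr => j /negPf nji; rewrite mxE nji.
Qed.

Lemma leibniz_mxtraceX n (M : 'M_n) k :
  d (\tr (M ^+ k.+1)) = \tr (map_mx d M *m M ^+ k) *+ k.+1.
Proof.
(* The factor [M ^+ j] collects, by cyclicity of the trace, the factors peeled off in the
   induction. *)
suff H j : \tr (map_mx d (M ^+ k.+1) *m M ^+ j)
             = \tr (map_mx d M *m M ^+ (k + j)) *+ k.+1.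
  by have:= H 0; rewrite expr0 mulmx1 addn0 raddf_mxtrace.
elim: k j => [|k IHk] j; first by rewrite expr1 add0n.
rewrite exprS -[_ * _]/(_ *m _) leibniz_mulmx mulmxDl mxtraceD -!mulmxA.
rewrite (mxtrace_mulC M) -mulmxA -[_ *m M]/(_ * M) -exprSr IHk addSnnS.
by rewrite -[_ *m M ^+ j]/(_ * _) -exprD addSnnS -mulrS.
Qed.

End Derivation.

Lemma leibniz_deriv (B : comNzRingType) : leibniz (@deriv B).
Proof. by move=> p q; rewrite derivM. Qed.

(** * Traces of powers, characteristic polynomial and nilpotency *)

Section NewtonIdentities.
Variables (A : comNzRingType) (n : nat) (H : 'M[A]_n).
Let p := char_poly H.

(* Faddeev-LeVerrier: the coefficients C k of 'X * adj ('X - H) satisfy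
   C k = p_k + H C (k + 1), and their traces are those of 'X * p'. *)
Lemma newton_char_poly k :
  p`_k *+ k = \sum_(i < n.+1) p`_(k + i) * \tr (H ^+ i).
Proof.
pose adjH := \adj (char_poly_mx H).
pose C k : 'M_n := map_mx (coefp k) ('X *: adjH).
have CS l : C l = (p`_l)%:M + H *m C l.+1.
  have: 'X *: adjH - map_mx polyC H *m adjH = p%:M.
    by rewrite -mul_scalar_mx -mulmxBl mul_mx_adj.
  move/eqP; rewrite subr_eq => /eqP E; rewrite {1}/C E; apply/matrixP=> i j.
  rewrite !mxE /= coefD coef_sum; congr (_ + _).
    by rewrite coefMn.
  by apply: eq_bigr => s _; rewrite !mxE coefCM /= coefXM.
have trC l : \tr (C l) = p`_l *+ l.
  rewrite raddf_mxtrace mxtraceZ /= coefXM.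
  have ->: \tr adjH = p^`().
    rewrite /p /char_poly (leibniz_det (@leibniz_deriv A)).
    rewrite (_ : map_mx _ _ = 1%:M) ?mul1mx //; apply/matrixP=> i j.
    by rewrite !mxE /= derivB derivC subr0 derivMn derivX.
  by rewrite coef_deriv; case: l.
have unroll N l : \tr (C l) =
    \sum_(i < N) p`_(l + i) * \tr (H ^+ i) + \tr (H ^+ N *m C (l + N)%N).
  elim: N => [|N IHN]; first by rewrite big_ord0 add0r expr0 addn0 mul1mx.
  rewrite IHN big_ord_recr /= -addrA (CS (l + N)%N) mulmxDr mxtraceD.
  by rewrite mul_mx_scalar mxtraceZ mulmxA -[_ *m H]/(_ * H) -exprSr addnS.
(* From [K] on the [C l] vanish, so the unrolled recursion ends. *)
pose K := \max_i \max_j size (('X *: adjH) i j).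
have C0 l : (K <= l)%N -> C l = 0.
  move=> leKl; apply/matrixP=> i j; rewrite mxE [RHS]mxE /= nth_default //.
  apply: leq_trans leKl; apply: leq_trans (leq_bigmax i).
  exact: (leq_bigmax (F := fun j => size (('X *: adjH) i j))).
have lenN: (n.+1 <= n.+1 + K)%N by rewrite leq_addr.
rewrite -trC (unroll (n.+1 + K)%N) C0 ?mulmx0 ?mxtrace0 ?addr0; last first.
  by rewrite addnCA !addnA leq_addl.
rewrite (big_ord_widen _ (fun i => p`_(k + i) * \tr (H ^+ i)) lenN).
rewrite [LHS](bigID (fun i : 'I__ => (i < n.+1)%N)) /=.
rewrite [X in _ + X]big1 ?addr0 //.
move=> i; rewrite -leqNgt => lt_ni; rewrite nth_default ?mul0r //.
by rewrite size_char_poly (leq_trans lt_ni) // leq_addl.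
Qed.

(** Newton's identity at [k] collapses to [k p_k = n p_k], and [n - k] cancels when [k < n]. *)
Lemma char_poly_mxtrace_eq0 :
    (forall (x : A) k, x *+ k.+1 = 0 -> x = 0) ->
    (forall k, (1 <= k <= n)%N -> \tr (H ^+ k) = 0) ->
  p = 'X^n.
Proof.
move=> tf trH; apply/polyP=> k; rewrite coefXn.
have [ltkn|ltnk|->] := ltngtP k n.
- apply: (tf _ (n - k.+1)%N); rewrite -subSn // subSS.
  have:= newton_char_poly k; rewrite big_ord_recl addn0 expr0.
  rewrite mxtrace1 mulr_natr.
  rewrite big1 ?addr0 => [E|].
    by rewrite mulrnBr ?(ltnW ltkn) // E subrr.
  by move=> i _; rewrite trH ?mulr0 //= lift0 ltn_ord.
- by rewrite nth_default // size_char_poly.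
- by have:= char_poly_monic H; rewrite monicE lead_coefE size_char_poly => /eqP.
Qed.

(** In Newton's identity at [n - k] the left side vanishes and only the term [i = k] survives on the
    right. *)
Lemma mxtrace_char_polyXn k :
  p = 'X^n -> (1 <= k <= n)%N -> \tr (H ^+ k) = 0.
Proof.
move=> pE /andP[k_gt0 le_kn]; have:= newton_char_poly (n - k).
have lt_kn : (k < n.+1)%N by rewrite ltnS.
rewrite pE coefXn (bigD1 (Ordinal lt_kn)) //= coefXn subnK // eqxx mul1r.
rewrite ltn_eqF ?mul0rn; last by rewrite -subn_gt0 subKn.
rewrite big1 ?addr0 // => i; rewrite -val_eqE /= => nik; rewrite coefXn.
by rewrite -(eqn_add2r k) addnAC subnK // eqn_add2l (negPf nik) mul0r.
Qed.

End NewtonIdentities.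

(** Over a domain 'X is prime: it divides [p] or [q], and cancelling it lowers [N]. *)
Lemma monic_dvd_polyXn (A : comNzRingType) (p q : {poly A}) N :
    (forall x y : A, x * y = 0 -> x = 0 \/ y = 0) ->
  p \is monic -> p * q = 'X^N -> exists k, p = 'X^k.
Proof.
move=> A_dom; have factX (r : {poly A}) : r`_0 = 0 -> exists s, r = s * 'X.
  move=> r0; exists (drop_poly 1 r).
  rewrite -{1}(poly_take_drop 1 r) expr1 (_ : take_poly 1 r = 0) ?add0r //.
  by apply/polyP=> i; rewrite coef_take_poly coef0; case: i.
have mulXI : injective (fun r : {poly A} => r * 'X) by exact/monic_rreg/monicX.
elim: N p q => [|N IHN] p q p_mon pq.
  have q0 : q != 0.
    by apply: contra_eq_neq pq => ->; rewrite mulr0 eq_sym oner_neq0.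
  have := size_monicM p_mon q0; rewrite pq size_poly1 => szE.
  have : (size p <= 1)%N.
    rewrite [leqRHS]szE; move: q0; rewrite -size_poly_gt0.
    case: (size q) => // s _.
    by rewrite addnS leq_addr.
  move/size1_polyC=> pE; move: p_mon; rewrite pE monicE lead_coefC => /eqP->.
  by exists 0.
have /A_dom[] : p`_0 * q`_0 = 0 by rewrite -coef0M pq coefXn.
  case/factX=> s sE; move: p_mon pq; rewrite {p}sE.
  rewrite (monicMr _ (monicX A)) => s_mon.
  rewrite mulrAC exprSr => /mulXI/(IHN _ _ s_mon)[k ->].
  by exists k.+1; rewrite exprSr.
case/factX=> s sE; apply: (IHN p s p_mon); apply: mulXI.
by rewrite -mulrA -sE pq exprSr.
Qed.

Lemma mxtrace_eq0_iff_nilpotent (A : comNzRingType) n (H : 'M[A]_n) :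
    (forall (x : A) k, x *+ k.+1 = 0 -> x = 0) ->
    (forall x y : A, x * y = 0 -> x = 0 \/ y = 0) ->
  (exists k, H ^+ k = 0) <-> (forall k, (1 <= k <= n)%N -> \tr (H ^+ k) = 0).
Proof.
case: n H => [|n] H tf A_dom.
  by split=> [_ [|k] //|_]; exists 0; apply/matrixP=> - [].
split=> [[k Hk]|/(char_poly_mxtrace_eq0 tf) pE]; last first.
  exists n.+1.
  by rewrite -[RHS](Cayley_Hamilton H) pE rmorphXn /= horner_mx_X.
suff pE : char_poly H = 'X^(n.+1) by move=> j; apply: mxtrace_char_polyXn.
(* Geometric sum for ['X^k - H^k], where [H^k = 0]; determinants then make [char_poly H] divide a
   power of 'X. *)
have [q qE] : exists q : 'M[{poly A}]_n.+1, char_poly_mx H *m q = ('X^k)%:M.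
  exists (\sum_(i < k) 'X%:M ^+ (k.-1 - i) * map_mx polyC H ^+ i).
  rewrite -[_ *m _]/(_ * _) -subrXX_comm.
    rewrite -[map_mx polyC H ^+ k]rmorphXn Hk raddf0 subr0.
    by rewrite -(rmorphXn scalar_mx).
  exact: comm_scalar_mx.
have [l pE] : exists l, char_poly H = 'X^l.
  apply: (monic_dvd_polyXn (q := \det q) (N := (k * n.+1)%N) A_dom).
    exact: char_poly_monic.
  by rewrite /char_poly -det_mulmx qE det_scalar exprM.
rewrite pE; congr ('X^_); apply/succn_inj.
by rewrite -(size_char_poly H) pE size_polyXn.
Qed.

(** * Gradient, Laplacian and Hessian for commuting derivations *)

Section Operators.
Variables (B : comNzRingType) (n : nat) (d : 'I_n -> {additive B -> B}).

Definition sqgrad x := \sum_i d i x ^+ 2.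
Definition laplacian x := \sum_i d i (d i x).
Definition hessian x : 'M_n := \matrix_(i, j) d i (d j x).

Lemma laplacianMn x k : laplacian (x *+ k) = laplacian x *+ k.
Proof. by rewrite -sumrMnl; apply: eq_bigr => i _; rewrite !raddfMn. Qed.

Lemma mxtrace_hessian x : \tr (hessian x) = laplacian x.
Proof. by apply: eq_bigr => i _; rewrite mxE. Qed.

Hypothesis dM : forall i, leibniz (d i).
Hypothesis dC : forall i j x, d i (d j x) = d j (d i x).

Lemma hessian_sqgrad x :
  hessian (sqgrad x) =
    (hessian x *m hessian x + \sum_l d l x *: map_mx (d l) (hessian x)) *+ 2.
Proof.
apply/matrixP=> i j; rewrite mxE /sqgrad !raddf_sum /= mulmxnE !mxE summxE.
rewrite -big_split -sumrMnl; apply: eq_bigr => l _ /=; rewrite !mxE.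
rewrite leibnizX // expr1 raddfMn dM addrC; congr ((_ + _) *+ 2).
  by rewrite mulrC (dC j l) (dC i l).
by rewrite mulrC (dC j l).
Qed.

(** When [x] solves the Hamilton-Jacobi equation, the [sqgrad] term is the time derivative of
    [x ^+ k.+1]. *)
Lemma laplacianX x k :
  laplacian (x ^+ k.+2) =
    (laplacian x * x ^+ k.+1 + (sqgrad x * x ^+ k) *+ k.+1) *+ k.+2.
Proof.
rewrite /laplacian /sqgrad !mulr_suml -sumrMnl -big_split -sumrMnl.
apply: eq_bigr => i _ /=.
by rewrite leibnizX // raddfMn dM leibnizX // mulrnAr mulrA expr2.
Qed.

End Operators.

(** * The Hamilton-Jacobi flow and its Taylor coefficients in t *)

Section HamiltonJacobi.
Variables (A : comNzRingType) (n : nat) (d : 'I_n -> {additive A -> A}).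
Hypothesis dM : forall i, leibniz (d i).
Hypothesis dC : forall i j x, d i (d j x) = d j (d i x).
Hypothesis A_tf : forall (x : A) k, x *+ k.+1 = 0 -> x = 0.
Hypothesis A_div : forall (x : A) k, exists y, y *+ k.+1 = x.

(** Acts on coefficients only: t is a constant for [dp i]. *)
Let dp i : {additive {poly A} -> {poly A}} := map_poly (d i).

Lemma map_poly_leibniz i : leibniz (dp i).
Proof.
move=> p q; apply/polyP=> k; rewrite coef_map coefD !coefM raddf_sum.
rewrite -big_split; apply: eq_bigr => l _ /=.
by rewrite (dM i) !coef_map.
Qed.

Lemma map_poly_comm i j p : dp i (dp j p) = dp j (dp i p).
Proof. by apply/polyP=> k; rewrite !coef_map; apply: dC. Qed.

Lemma map_poly_deriv i p : dp i p^`() = (dp i p)^`().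
Proof. by apply/polyP=> k; rewrite coef_map !coef_deriv raddfMn coef_map. Qed.

Lemma map_polyMXn i p N : dp i (p * 'X^N) = dp i p * 'X^N.
Proof.
apply/polyP=> k; rewrite coef_map !coefMXn coef_map.
by case: ifP => // _; apply: raddf0.
Qed.

Lemma coef_laplacian p k : (laplacian dp p)`_k = laplacian d p`_k.
Proof. by rewrite coef_sum; apply: eq_bigr => i _; rewrite !coef_map. Qed.

(* The Cauchy problem dS/dt = |grad S|^2, S(0) = P, solved modulo t^N,
   where t is the variable 'X of {poly A}. *)
Lemma hamilton_jacobi P N :
  exists S e : {poly A}, S`_0 = P /\ S^`() = sqgrad dp S + e * 'X^N.
Proof.
elim: N => [|N [S [e [S0 dS]]]].
  exists P%:P, (P%:P^`() - sqgrad dp P%:P).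
  by rewrite coefC expr0 mulr1 addrC subrK.
(* The derivative of [c t^(N+1)] must cancel the lowest error term [e_0 t^N]; [r t^(N+1)] is the
   resulting change of the squared gradient. *)
have [c cE] := A_div (- e`_0) N.
pose T := c%:P * 'X^(N.+1).
pose r := \sum_i (dp i S * (dp i c%:P) *+ 2 + (dp i c%:P) ^+ 2 * 'X^(N.+1)).
exists (S + T), (drop_poly 1 e - r); split.
  by rewrite coefD coefCM coefXn mulr0 addr0.
have -> : sqgrad dp (S + T) = sqgrad dp S + r * 'X^(N.+1).
  rewrite /sqgrad mulr_suml -big_split; apply: eq_bigr => i _ /=.
  rewrite raddfD map_polyMXn; ring.
have -> : (S + T)^`() = S^`() - (e`_0)%:P * 'X^N.
  rewrite derivD derivM derivC mul0r add0r derivXn mulrnAr -mulrnAl.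
  by rewrite -polyCMn cE polyCN mulNr.
have eE : e = (e`_0)%:P + drop_poly 1 e * 'X.
  apply/polyP=> k; rewrite coefD coefC coefMX coef_drop_poly.
  by case: k => [|k] /=; rewrite ?addr0 // add0r addn1.
rewrite dS exprS {1}eE; ring.
Qed.

Section Flow.
Variables (N : nat) (P : A) (S e : {poly A}).
Hypotheses (S0 : S`_0 = P) (dS : S^`() = sqgrad dp S + e * 'X^N).

Let w k := \tr (hessian dp S ^+ k).
Let u k := \tr (hessian d P ^+ k).

Lemma mxtrace_flow0 k : (w k)`_0 = u k.
Proof.
rewrite -[LHS]/(coefp 0 _) -trace_map_mx rmorphXn; congr (\tr (_ ^+ _)).
by apply/matrixP=> i j; rewrite !mxE /= !coef_map /= -S0.
Qed.

(** By [hessian_sqgrad], the squared Hessian raises the exponent of the trace, and the transport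
    terms recombine into derivatives of [w k.+1]. *)
Lemma mxtrace_flow k : exists r,
  (w k.+1)^`() = w k.+2 *+ (2 * k.+1)
               + (\sum_l dp l S * dp l (w k.+1)) *+ 2 + r * 'X^N.
Proof.
pose M := hessian dp S.
have dM' : map_mx (@deriv A) M =
    (M *m M + \sum_l dp l S *: map_mx (dp l) M) *+ 2 + 'X^N *: hessian dp e.
  rewrite -hessian_sqgrad; [|exact: map_poly_leibniz|exact: map_poly_comm].
  apply/matrixP=> i j; rewrite !mxE -!map_poly_deriv dS !raddfD /=.
  by rewrite !map_polyMXn mulrC.
exists (\tr (hessian dp e *m M ^+ k) *+ k.+1).
rewrite (leibniz_mxtraceX (@leibniz_deriv A)) dM' mulmxDl mxtraceD mulrnDl.
rewrite -scalemxAl mxtraceZ mulrC mulrnAl; congr (_ + _).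
rewrite mulr2n mulmxDl mxtraceD -mulr2n mulmxDl mxtraceD -mulmxA.
rewrite -[M *m (M *m _)]/(M * (M * _)) -!exprS mulmx_suml raddf_sum /=.
rewrite -mulrnA mulrnDl; congr (_ + _); rewrite mulrnA mulrnAC.
congr (_ *+ 2); rewrite -sumrMnl; apply: eq_bigr => l _.
rewrite -scalemxAl mxtraceZ leibniz_mxtraceX ?mulrnAr //.
exact: map_poly_leibniz.
Qed.

(** Comparing t^j-coefficients in [mxtrace_flow] gives [(j+1) w_(k+1),j+1 = 2(k+1) w_(k+2),j], which
    builds up the power of 2 and the binomial. *)
Lemma mxtrace_flow_coef m j k :
    (m <= N)%N -> (forall l, (0 < l < m)%N -> u l = 0) -> (k.+1 + j <= m)%N ->
  (w k.+1)`_j = u (k.+1 + j)%N *+ (2 ^ j * 'C(k + j, j)).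
Proof.
move=> le_mN u0; elim/ltn_ind: j k => -[|j] IHj k le_m.
  by rewrite mxtrace_flow0 addn0 bin0 mulr1n.
have le_m' : (k.+2 + j <= m)%N by rewrite addSnnS.
apply: subr0_eq; apply: (A_tf (k := j)); rewrite mulrnBl -coef_deriv.
have [r ->] := mxtrace_flow k.
rewrite 2!coefD coefMXn (leq_trans _ le_mN) ?addr0; last first.
  exact: leq_trans (leq_addl _ _) le_m.
rewrite coefMn (IHj j) // coefMn coef_sum big1 => [|l _].
  rewrite mul0rn addr0 addSnnS -!mulrnA.
  apply/eqP; rewrite subr_eq0; apply/eqP; congr (_ *+ _).
  have := mul_bin_left (k + j.+1) j.
  rewrite addnS subSn ?leq_addl // addnK => E.
  by rewrite expnS addSn -[RHS]mulnA [('C(_, j.+1) * _)%N]mulnC E; ring.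
(* Transport term: up to t^j, [w k.+1] has coefficients that are multiples of [u l] with
   [0 < l < m], hence zero. *)
rewrite mulrC coefM big1 // => i _; rewrite !coef_map /=.
have lt_ij : (i < j.+1)%N by [].
have lt_m : (k.+1 + i < m)%N by apply: leq_trans le_m; rewrite ltn_add2l.
by rewrite (IHj i) ?(ltnW lt_m) // u0 ?mul0rn ?raddf0 ?mul0r.
Qed.

(** Below t^m the Laplacian of [S] vanishes, so that of [S ^+ k.+2] agrees there with [k+2] times
    the t-derivative of [S ^+ k.+1]: each Laplacian trades a power of [S] for a power of t. *)
Lemma laplacian_powers_flow m :
    (m.+1 <= N)%N -> (forall l, (0 < l < m.+1)%N -> u l = 0) ->
  forall j k, (j <= m)%N -> exists c,
    (0 < c)%N /\ iter j (laplacian d) (P ^+ (k.+1 + j)) = (S ^+ k.+1)`_j *+ c.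
Proof.
move=> le_mN u0; elim=> [|j IHj] k lt_jm.
  exists 1%N; split=> //; rewrite addn0 mulr1n -S0.
  by rewrite -![_`_0]/(coefp 0 _) rmorphXn.
have [c [c_gt0 cE]] := IHj k.+1 (ltnW lt_jm).
exists (j.+1 * k.+2 * c)%N; split; first by rewrite !muln_gt0 c_gt0.
have lapS l : (l < m)%N -> (laplacian dp S)`_l = 0.
  move=> lt_lm.
  have -> : laplacian dp S = w 1 by rewrite /w expr1 mxtrace_hessian.
  by rewrite (mxtrace_flow_coef le_mN u0) ?add1n ?u0 ?mul0rn // ltnW.
rewrite iterS -addSnnS cE laplacianMn -coef_laplacian laplacianX; last first.
- exact: map_poly_leibniz.
have -> : (sqgrad dp S * S ^+ k) *+ k.+1
            = (S ^+ k.+1)^`() - (e * S ^+ k) *+ k.+1 * 'X^N.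
  by rewrite (leibnizX (@leibniz_deriv A)) /= dS; ring.
rewrite coefMn !coefD coefN coefMXn (leq_trans lt_jm (ltnW le_mN)) subr0.
rewrite coefM big1 ?add0r => [|i _]; last first.
  by rewrite lapS ?mul0r // (leq_ltn_trans _ lt_jm) // -ltnS.
by rewrite coef_deriv !mulrnA.
Qed.

End Flow.

Lemma laplacian_pow_mxtrace P m :
    (forall l, (0 < l < m.+1)%N -> \tr (hessian d P ^+ l) = 0) ->
  exists c, (0 < c)%N /\
    iter m.+1 (laplacian d) (P ^+ m.+1) = \tr (hessian d P ^+ m.+1) *+ c.
Proof.
move=> u0; have [S [e [S0 dS]]] := hamilton_jacobi P m.+1.
have [c [c_gt0 cE]] := laplacian_powers_flow S0 dS (leqnn _) u0 0 (leqnn m).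
(* One last Laplacian turns the t^m-coefficient of [S] into that of [w 1], which is
   [2^m u_(m+1)]. *)
exists (2 ^ m * c)%N; split; first by rewrite muln_gt0 expn_gt0.
rewrite iterS -add1n cE laplacianMn -coef_laplacian expr1 -mxtrace_hessian.
rewrite -[hessian dp S]expr1 (mxtrace_flow_coef S0 dS (leqnn _) u0) //.
by rewrite add0n binn muln1 mulrnA.
Qed.

(** Strong induction on the triangular relation [laplacian_pow_mxtrace], cancelling its positive
    constant. *)
Lemma mxtrace_hessian_eq0_iff P N :
  (forall k, (1 <= k <= N)%N -> \tr (hessian d P ^+ k) = 0) <->
  (forall m, (1 <= m <= N)%N -> iter m (laplacian d) (P ^+ m) = 0).
Proof.
split=> H [|m] // /andP[_ le_mN].
  have [l /andP[l_gt0 lt_lm]|c [_ ->]] := @laplacian_pow_mxtrace P m.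
    by rewrite H // l_gt0 (leq_trans _ le_mN) // ltnW.
  by rewrite H ?mul0rn.
elim/ltn_ind: m le_mN => m IHm le_mN.
have [[|l] // lt_lm|[|c] [// _]] := @laplacian_pow_mxtrace P m.
  by rewrite IHm // (leq_trans (ltnW lt_lm)).
by rewrite H // => /esym/A_tf.
Qed.

End HamiltonJacobi.

(** * Formal power series: derivations, torsion, integrality *)

Section PowerSeries.
Variables (n : nat) (R : comNzRingType).
Implicit Types (e f g : fpseries n R) (m : 'X_{1..n}).

Fact fpderiv_is_additive i : zmod_morphism (@fpderiv n R i).
Proof. by move=> f g; apply/fpseriesP=> m /=; rewrite mulrnBl. Qed.

HB.instance Definition _ i :=
  GRing.isZmodMorphism.Build _ _ (@fpderiv n R i) (fpderiv_is_additive i).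

Lemma fpderiv_leibniz i : leibniz (@fpderiv n R i).
Proof.
(* Reduction to polynomials; truncation keeps one degree beyond [mdeg m], as a derivative reads the
   coefficient at [m + U_(i)]. *)
move=> f g; apply/fpseriesP=> m; pose d := (mdeg m).+1.
have trE e k : (mdeg k < d.+1)%N -> (fptrunc d.+1 e)@_k = e k.
  by move=> lt_kd; rewrite mcoeff_fptrunc lt_kd.
have trdE e k :
    (mdeg k < d)%N -> (mderiv i (fptrunc d.+1 e))@_k = fpderiv i e k.
  by move=> lt_kd; rewrite mcoeff_deriv trE // mdegD mdeg1 addn1 ltnS.
have trE' e k : (mdeg k < d)%N -> (fptrunc d.+1 e)@_k = e k.
  by move=> lt_kd; rewrite trE // ltnW.
rewrite -[LHS]/(fpsM f g (m + U_(i))%MM *+ (m i).+1).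
rewrite (fpsM_mcoeff (trE f) (trE g)) ?mdegD ?mdeg1 ?addn1 // -mcoeff_deriv.
rewrite mderivM mcoeffD.
rewrite -[RHS]/(fpsM (fpderiv i f) g m + fpsM f (fpderiv i g) m).
by rewrite (fpsM_mcoeff (trdE f) (trE' g)) // (fpsM_mcoeff (trE' f) (trdE g)).
Qed.

Lemma fpderivC i j f : fpderiv i (fpderiv j f) = fpderiv j (fpderiv i f).
Proof.
apply/fpseriesP=> m /=; rewrite -!mulrnA !mnmDE !mnm1E.
rewrite -!addmA [(U_(j) + _)%MM]addmC.
congr (_ *+ _).
by case: (eqVneq j i) => [->|nij]; rewrite ?eqxx // !addn0 mulnC.
Qed.

Lemma fpcoefMn f k m : (f *+ k) m = f m *+ k.
Proof. by elim: k => // k IHk; rewrite !mulrS -IHk. Qed.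

End PowerSeries.

Lemma fpseries_torsion_free n (K : numDomainType) (f : fpseries n K) k :
  f *+ k.+1 = 0 -> f = 0.
Proof.
move=> fk0; apply/fpseriesP=> m; apply/eqP.
by have /eqP := fpcoefMn f k.+1 m; rewrite fk0 eq_sym Num.Theory.mulrn_eq0.
Qed.

Lemma fpseries_divisible n (K : numFieldType) (f : fpseries n K) k :
  exists g, g *+ k.+1 = f.
Proof.
pose g := FPSeries (fun m => f m / k.+1%:R).
exists g; apply/fpseriesP=> m.
by rewrite fpcoefMn -mulr_natr divfK // Num.Theory.pnatr_eq0.
Qed.

(** For the monomial order, the least monomials [a] of [f] and [b] of [g] alone contribute to the
    coefficient at [a + b]. *)
Lemma fpseries_integral n (K : idomainType) (f g : fpseries n K) :
  f * g = 0 -> f = 0 \/ g = 0.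
Proof.
have minsupp (h : fpseries n K) : h <> 0 ->
    exists m, h m != 0 /\ forall k, (k < m)%O -> h k = 0.
  move=> h0; apply: contrapT => hN; apply: h0; apply/fpseriesP.
  elim/(well_founded_ind (@ltom_wf n)) => m IHm; apply/eqP/contraT => hm0.
  by case: hN; exists m.
move=> fg0; apply: contrapT.
move=> /not_orP[/minsupp[a [fa0 fmin]] /minsupp[b [gb0 gmin]]].
have: (f * g) (a + b)%MM == 0 by rewrite fg0.
have lt_a : (mdeg a < (mdeg (a + b)).+1)%N by rewrite ltnS mdegD leq_addr.
rewrite [_ (a + b)%MM](bigD1 (BMultinom lt_a)) /=; last exact: lem_addr.
rewrite big1 ?addr0 => [|k /andP[le_k nka]].
  by rewrite addmC addmK mulf_eq0 (negPf fa0) (negPf gb0).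
have [/fmin->|lt_ak|ka] := Order.TotalTheory.ltgtP (bmnm k) a.
- by rewrite mul0r.
- by rewrite gmin ?mulr0 // -(ltmc_add2r (bmnm k)) addmC submK ?ltmc_add2l //.
- by case/eqP: nka; apply/val_inj.
Qed.

Theorem theorem4p3 (R : realType) (n : nat) (n_ge1 : (1 <= n)%N)
    (P : fpseries n R[i]) (P_order : fporder_ge P 2) :
  (hessian_nilpotent P <->
     (forall m : nat, (1 <= m)%N -> iter m (@fplaplacian n R[i]) (P ^+ m) = 0)) /\
  ((forall m : nat, (1 <= m)%N -> iter m (@fplaplacian n R[i]) (P ^+ m) = 0) <->
     (forall m : nat, (1 <= m <= n)%N ->
        iter m (@fplaplacian n R[i]) (P ^+ m) = 0)).
Proof.
pose d i : {additive _ -> _} := @fpderiv n R[i] i.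
have tf := @fpseries_torsion_free n R[i].
have traceP N := mxtrace_hessian_eq0_iff (@fpderiv_leibniz n R[i])
  (@fpderivC n R[i]) tf (@fpseries_divisible n R[i]) P N.
have nilP (H : 'M[fpseries n R[i]]_n) :=
  mxtrace_eq0_iff_nilpotent H tf (@fpseries_integral n R[i]).
have upto_n : (forall m, (1 <= m <= n)%N ->
    iter m (@fplaplacian n R[i]) (P ^+ m) = 0) -> hessian_nilpotent P.
  by move/(traceP n)/nilP.
have all_m : hessian_nilpotent P -> forall m, (1 <= m)%N ->
    iter m (@fplaplacian n R[i]) (P ^+ m) = 0.
  move=> [k Hk] m m_gt0; apply: (iffLR (traceP m)); last by rewrite m_gt0 leqnn.
  (* Since [l] may exceed [n], [nilP] is applied to the nilpotent matrix [fphessian P ^+ l] with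
     exponent 1, in range because [n >= 1]. *)
  move=> l /andP[l_gt0 _]; rewrite -[_ ^+ l]expr1.
  apply: (iffLR (nilP _)) => //.
  by exists k; rewrite -exprM mulnC exprM Hk expr0n eqn0Ngt l_gt0.
split; split=> [H|H] //.
- exact: all_m.
- by apply: upto_n => m /andP[/H].
- by move=> m /andP[/H].
- exact/all_m/upto_n.
Qed.
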